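(* Let $\Xi,\Xi'\in\mathrm{SPD}(n)$, $k\le n$, and let $(\Psi,\Phi)$ be the test and trial basis matrices of an inner-product balancing of $\Xi$ and $\Xi'$, with associated diagonal matrix $\Sigma_1$ of the $k$ largest singular values. Let $(A,B,C)$ be an LTI system with $A\in\mathbb{R}^{n\times n}$. Then: (a) The test and trial basis matrices $(\Psi,\Phi)$ correspond to an inner-product projection performed on $(A,B,C)$ with $M=\Xi$ and $N=\Sigma_1$; that is, $\Phi\in O(\Xi,\Sigma_1)$ and $\Psi=\Xi\Phi\Sigma_1^{-1}$. (b) The test and trial basis matrices $(\Phi,\Psi)$ correspond to an inner-product projection performed on the dual system $(A^{\tau},C^{\tau},B^{\tau})$ with $M'=\Xi'$ and $N'=\Sigma_1$; that is, $\Psi\in O(\Xi',\Sigma_1)$ and $\Phi=\Xi'\Psi\Sigma_1^{-1}$. (c) $(\Psi,\Phi)$ balance $\Xi$ and $\Xi'$, i.e. $\Phi\in O(\Xi,\Sigma_1)$ and $\Psi\in O(\Xi',\Sigma_1)$.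
   Context: $\mathrm{SPD}(n)$: real symmetric positive-definite $n\times n$ matrices; $\tau$ denotes transpose. For $M\in\mathrm{SPD}(n)$, $N\in\mathrm{SPD}(k)$, $O(M,N)$ is the set of real full-column-rank $n\times k$ matrices $V$ with $V^{\tau}MV=N$. A pair (test, trial) $=(\Psi,\Phi)$ corresponds to an inner-product projection with $M\in\mathrm{SPD}(n)$ and $N\in\mathrm{SPD}(k)$ if $\Phi\in O(M,N)$ and $\Psi=M\Phi N^{-1}$; the reduced model is then $(\Psi^{\tau}A\Phi,\Psi^{\tau}B,C\Phi)$. Inner-product balancing: write $\Xi=RR^{\tau}$, $\Xi'=SS^{\tau}$ with $R,S\in\mathbb{R}^{n\times n}$, take a singular value decomposition $R^{\tau}S=U\Sigma V^{\tau}$ with singular values in decreasing order, and partition $U=[U_1\ U_2]$, $\Sigma=\mathrm{diag}(\Sigma_1,\Sigma_2)$, $V=[V_1\ V_2]$, where $U_1,V_1\in\mathbb{R}^{n\times k}$ have orthonormal columns and $\Sigma_1=\mathrm{diag}(\sigma_1,\ldots,\sigma_k)$ contains the $k$ largest singular values; then $\Phi=SV_1\Sigma_1^{-1/2}$ and $\Psi=RU_1\Sigma_1^{-1/2}$. *)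

(* Defs.v *)
From mathcomp Require Import all_boot all_order all_algebra.
From mathcomp Require Import reals.
Set Implicit Arguments.
Unset Strict Implicit.
Unset Printing Implicit Defensive.
Import Order.TTheory GRing.Theory Num.Theory.
Local Open Scope ring_scope.

Definition SPD (R : realType) (n : nat) (M : 'M[R]_n) : Prop :=
  M^T = M /\ forall x : 'cV[R]_n, x != 0 -> 0 < (x^T *m M *m x) 0 0.

(* Membership in the set O(M, N); only meaningful for M and N in SPD. *)
Definition O_mx (R : realType) (n k : nat) (M : 'M[R]_n) (N : 'M[R]_k)
    (V : 'M[R]_(n, k)) : Prop :=
  \rank V = k /\ V^T *m M *m V = N.

(* LTI systems (A, B, C) with n states, p inputs and q outputs.  The time
   domain (continuous or discrete) plays no role. *)
Record lti (R : realType) (n p q : nat) := LTI {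
  lti_A : 'M[R]_n;
  lti_B : 'M[R]_(n, p);
  lti_C : 'M[R]_(q, n)
}.

Definition dual_lti (R : realType) (n p q : nat) (sys : lti R n p q) :
    lti R n q p :=
  LTI (lti_A sys)^T (lti_C sys)^T (lti_B sys)^T.

Definition reduced_model (R : realType) (n k p q : nat)
    (Psi Phi : 'M[R]_(n, k)) (sys : lti R n p q) : lti R k p q :=
  LTI (Psi^T *m lti_A sys *m Phi) (Psi^T *m lti_B sys) (lti_C sys *m Phi).

(* The (test, trial) pair (Psi, Phi) corresponds to the inner-product
   projection of [sys] with respect to M and N, whose reduced model is [red]. *)
Definition ip_projection (R : realType) (n k p q : nat) (sys : lti R n p q)
    (M : 'M[R]_n) (N : 'M[R]_k) (Psi Phi : 'M[R]_(n, k))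
    (red : lti R k p q) : Prop :=
  [/\ SPD M, SPD N, O_mx M N Phi, Psi = M *m Phi *m invmx N
    & red = reduced_model Psi Phi sys].

Definition is_svd (R : realType) (n : nat) (X U : 'M[R]_n) (s : 'rV[R]_n)
    (V : 'M[R]_n) : Prop :=
  [/\ U^T *m U = 1%:M,
      V^T *m V = 1%:M,
      forall i : 'I_n, 0 <= s 0 i,
      forall i j : 'I_n, (i <= j)%N -> s 0 j <= s 0 i
    & X = U *m diag_mx s *m V^T].

Definition first_cols (R : realType) (m n k : nat) (le_kn : (k <= n)%N)
    (X : 'M[R]_(m, n)) : 'M[R]_(m, k) :=
  colsub (widen_ord le_kn) X.

(* The power -1/2 of the diagonal matrix with diagonal s. *)
Definition diag_inv_sqrt (R : realType) (k : nat) (s : 'rV[R]_k) : 'M[R]_k :=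
  diag_mx (map_mx (fun x => (Num.sqrt x)^-1) s).

(* The factors and the SVD are not unique: (Psi, Phi), with diagonal matrix
   Sigma1, arises from some choice of them. *)
Definition ip_balancing (R : realType) (n k : nat) (le_kn : (k <= n)%N)
    (Xi Xi' : 'M[R]_n) (Psi Phi : 'M[R]_(n, k)) (Sigma1 : 'M[R]_k) : Prop :=
  exists (P S U V : 'M[R]_n) (s : 'rV[R]_n),
    let s1 := first_cols le_kn s in
    let U1 := first_cols le_kn U in
    let V1 := first_cols le_kn V in
    [/\ Xi = P *m P^T /\ Xi' = S *m S^T,
        is_svd (P^T *m S) U s V,
        Sigma1 = diag_mx s1,
        Phi = S *m V1 *m diag_inv_sqrt s1
      & Psi = P *m U1 *m diag_inv_sqrt s1].

Definition balances (R : realType) (n k : nat) (Psi Phi : 'M[R]_(n, k))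
    (Xi Xi' : 'M[R]_n) (Sigma1 : 'M[R]_k) : Prop :=
  O_mx Xi Sigma1 Phi /\ O_mx Xi' Sigma1 Psi.

(* Main.v *)
Require Import Defs.
From mathcomp Require Import all_boot all_order all_algebra.
From mathcomp Require Import reals.
Set Implicit Arguments.
Unset Strict Implicit.
Unset Printing Implicit Defensive.
Import Order.TTheory GRing.Theory Num.Theory.
Local Open Scope ring_scope.

(** With [X = P^T S = U D V^T], the leading columns satisfy [X V1 = U1 D1], so
    [P^T Phi = U1 D1 ^ (1/2)].  Hence [Phi^T Xi Phi = D1] and
    [Xi Phi = P U1 D1 ^ (1/2) = Psi D1].  Transposing the decomposition of [X]
    exchanges the roles of [Xi] and [Xi'], which gives the dual half. *)

Lemma SPD_unitmx (R : realType) (n : nat) (M : 'M[R]_n) :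
  SPD M -> M \in unitmx.
Proof.
move=> [_ posM]; rewrite unitmxE unitfE; apply/negP => /det0P [v v_neq0 vM0].
have := posM v^T; rewrite trmx_eq0 => /(_ v_neq0).
by rewrite trmxK vM0 mul0mx mxE ltxx.
Qed.

(** Full column rank makes [W] injective, so a nonzero [x] gives a nonzero [W *m x], at which the
    form of [M] is positive. *)
Lemma SPD_congr (R : realType) (n k : nat) (M : 'M[R]_n) (W : 'M[R]_(n, k)) :
  SPD M -> \rank W = k -> SPD (W^T *m M *m W).
Proof.
move=> [symM posM] rkW; split=> [|x x_neq0].
  by rewrite !trmx_mul trmxK symM mulmxA.
have freeW : row_free W^T by rewrite /row_free mxrank_tr rkW.
have Wx_neq0 : W *m x != 0.
  apply: contra x_neq0 => /eqP Wx0.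
  rewrite -trmx_eq0 -(inj_eq (row_free_inj freeW)) mul0mx -trmx_mul Wx0.
  by rewrite trmx0.
by have := posM _ Wx_neq0; rewrite trmx_mul !mulmxA.
Qed.

Lemma is_svd_tr (R : realType) (n : nat) (X U V : 'M[R]_n) (s : 'rV[R]_n) :
  is_svd X U s V -> is_svd X^T V s U.
Proof.
move=> [UU VV s_ge0 s_decr ->]; split=> //.
by rewrite !trmx_mul trmxK tr_diag_mx mulmxA.
Qed.

(** Invertibility of [X] passes to its factor [diag_mx s], whose determinant is the product of the
    singular values; none of them can vanish. *)
Lemma is_svd_gt0 (R : realType) (n : nat) (X U V : 'M[R]_n) (s : 'rV[R]_n) :
  X \in unitmx -> is_svd X U s V -> forall i, 0 < s 0 i.
Proof.
move=> uX [_ _ s_ge0 _ defX] i; rewrite lt_def s_ge0 andbT.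
move: uX; rewrite defX !unitmx_mul => /andP[/andP[_ +] _].
by rewrite unitmxE det_diag unitfE => /prodf_neq0 /(_ i isT).
Qed.

Lemma first_cols_mul (R : realType) (m n l k : nat) (le_kl : (k <= l)%N)
    (X : 'M[R]_(m, n)) (Y : 'M[R]_(n, l)) :
  first_cols le_kl (X *m Y) = X *m first_cols le_kl Y.
Proof.
by apply/matrixP => i j; rewrite !mxE; apply: eq_bigr => l0 _; rewrite !mxE.
Qed.

Lemma first_cols_mul_diag (R : realType) (m n k : nat) (le_kn : (k <= n)%N)
    (X : 'M[R]_(m, n)) (s : 'rV[R]_n) :
  first_cols le_kn (X *m diag_mx s) =
  first_cols le_kn X *m diag_mx (first_cols le_kn s).
Proof. by apply/matrixP => i j; rewrite !mul_mx_diag !mxE. Qed.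

Lemma first_cols_orthonormal (R : realType) (n k : nat) (le_kn : (k <= n)%N)
    (U : 'M[R]_n) :
  U^T *m U = 1%:M -> (first_cols le_kn U)^T *m first_cols le_kn U = 1%:M.
Proof.
move=> UU; apply/matrixP => i j.
have /matrixP/(_ (widen_ord le_kn i) (widen_ord le_kn j)) := UU.
(* Widening keeps the value of an ordinal, so both identity matrices have the same entry here. *)
rewrite !mxE -val_eqE /= => <-.
by apply: eq_bigr => l _; rewrite !mxE.
Qed.

Lemma is_svd_first_cols (R : realType) (n k : nat) (le_kn : (k <= n)%N)
    (X U V : 'M[R]_n) (s : 'rV[R]_n) :
  is_svd X U s V ->
  X *m first_cols le_kn V =
  first_cols le_kn U *m diag_mx (first_cols le_kn s).
Proof.
move=> [_ VV _ _ ->].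
by rewrite -first_cols_mul -mulmxA VV mulmx1 first_cols_mul_diag.
Qed.

(** The SVD of [S^T *m P] is the transposed one, with [U] and [V] exchanged and the same singular
    values. This reduces the dual half to the primal one. *)
Lemma ip_balancing_sym (R : realType) (n k : nat) (le_kn : (k <= n)%N)
    (Xi Xi' : 'M[R]_n) (Psi Phi : 'M[R]_(n, k)) (Sigma1 : 'M[R]_k) :
  ip_balancing le_kn Xi Xi' Psi Phi Sigma1 ->
  ip_balancing le_kn Xi' Xi Phi Psi Sigma1.
Proof.
move=> [P [S [U [V [s [[XiE Xi'E] svd SigmaE PhiE PsiE]]]]]].
exists S, P, V, U, s; split=> //.
by have := is_svd_tr svd; rewrite trmx_mul trmxK.
Qed.

Lemma tr_diag_inv_sqrt (R : realType) (k : nat) (s : 'rV[R]_k) :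
  (diag_inv_sqrt s)^T = diag_inv_sqrt s.
Proof. exact: tr_diag_mx. Qed.

Lemma diag_inv_sqrtC (R : realType) (k : nat) (s t : 'rV[R]_k) :
  diag_mx t *m diag_inv_sqrt s = diag_inv_sqrt s *m diag_mx t.
Proof. exact: diag_mxC. Qed.

(** Positivity matters: the inverse of 0 is 0 by convention, so a zero entry of [s] would leave 0 on
    the diagonal. *)
Lemma diag_inv_sqrt_sqr (R : realType) (k : nat) (s : 'rV[R]_k) :
  (forall i, 0 < s 0 i) ->
  diag_inv_sqrt s *m diag_inv_sqrt s *m diag_mx s = 1%:M.
Proof.
move=> s_gt0; rewrite !mulmx_diag -diag_const_mx; congr diag_mx.
apply/rowP => i; rewrite !mxE -invfM -expr2 sqr_sqrtr ?ltW //.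
by rewrite mulVf ?gt_eqF.
Qed.

Lemma ip_balancing_test_trial (R : realType) (n k : nat) (le_kn : (k <= n)%N)
    (Xi Xi' : 'M[R]_n) (Psi Phi : 'M[R]_(n, k)) (Sigma1 : 'M[R]_k) :
  SPD Xi -> SPD Xi' -> ip_balancing le_kn Xi Xi' Psi Phi Sigma1 ->
  [/\ SPD Sigma1, O_mx Xi Sigma1 Phi & Psi = Xi *m Phi *m invmx Sigma1].
Proof.
move=> spdXi spdXi' [P [S [U [V [s [[XiE Xi'E] svd SigmaE PhiE PsiE]]]]]].
set s1 := first_cols le_kn s in SigmaE PhiE PsiE.
set U1 := first_cols le_kn U in PsiE; set V1 := first_cols le_kn V in PhiE.
set H := diag_inv_sqrt s1 in PhiE PsiE.
(* The square factors [P] and [S] inherit invertibility from [Xi] and [Xi']. *)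
have uX : P^T *m S \in unitmx.
  have := SPD_unitmx spdXi; have := SPD_unitmx spdXi'.
  by rewrite XiE Xi'E !unitmx_mul !unitmx_tr => /andP[-> _] /andP[-> _].
have s1_gt0 i : 0 < s1 0 i by rewrite mxE (is_svd_gt0 uX svd).
have HHD : H *m H *m Sigma1 = 1%:M by rewrite SigmaE diag_inv_sqrt_sqr.
have HC : Sigma1 *m H = H *m Sigma1 by rewrite SigmaE diag_inv_sqrtC.
have trSigma : Sigma1^T = Sigma1 by rewrite SigmaE tr_diag_mx.
have uSigma : Sigma1 \in unitmx by case: (mulmx1_unit HHD).
have UU1 : U1^T *m U1 = 1%:M.
  by apply: first_cols_orthonormal; case: svd.
(* Here [Sigma1 *m H] plays the role of the square root of [Sigma1]. *)
have PPhi : P^T *m Phi = U1 *m Sigma1 *m H.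
  by rewrite PhiE !mulmxA (is_svd_first_cols le_kn svd) SigmaE.
(* The left side is the Gram matrix of [P^T *m Phi]; orthonormality of [U1] leaves
   [H *m Sigma1 *m Sigma1 *m H], and commuting the diagonal factors brings out [HHD]. *)
have Phi_congr : Phi^T *m Xi *m Phi = Sigma1.
  rewrite XiE !mulmxA -(mulmxA _ P^T) -[P in Phi^T *m P]trmxK -trmx_mul PPhi.
  rewrite !trmx_mul tr_diag_inv_sqrt trSigma -/H !mulmxA -(mulmxA _ U1^T) UU1.
  by rewrite mulmx1 -mulmxA HC mulmxA -(mulmxA H) HC mulmxA HHD mul1mx.
(* The invertible [Sigma1] has rank [k] and is a product ending in [Phi], so its rank is at most
   that of [Phi]. *)
have rkPhi : \rank Phi = k.
  apply/eqP; rewrite eqn_leq rank_leq_col /=.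
  by rewrite -{1}(mxrank_unit uSigma) -Phi_congr mxrankM_maxr.
split=> //; first by rewrite -Phi_congr; apply: SPD_congr.
(* Moving [Sigma1] to the right of [H] lets it cancel against its inverse. *)
by rewrite XiE -[P *m _ *m Phi]mulmxA PPhi -(mulmxA U1) HC !mulmxA mulmxK.
Qed.

Theorem lemma3p10 (R : realType) (n k p q : nat) (le_kn : (k <= n)%N)
    (Xi Xi' : 'M[R]_n) (Psi Phi : 'M[R]_(n, k)) (Sigma1 : 'M[R]_k)
    (A : 'M[R]_n) (B : 'M[R]_(n, p)) (C : 'M[R]_(q, n)) :
  SPD Xi -> SPD Xi' ->
  ip_balancing le_kn Xi Xi' Psi Phi Sigma1 ->
  [/\ ip_projection (LTI A B C) Xi Sigma1 Psi Phi
        (reduced_model Psi Phi (LTI A B C)),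
      ip_projection (dual_lti (LTI A B C)) Xi' Sigma1 Phi Psi
        (reduced_model Phi Psi (dual_lti (LTI A B C)))
    & balances Psi Phi Xi Xi' Sigma1].
Proof.
move=> spdXi spdXi' bal.
have [spdS OPhi PsiE] := ip_balancing_test_trial spdXi spdXi' bal.
have [_ OPsi PhiE] := ip_balancing_test_trial spdXi' spdXi (ip_balancing_sym bal).
by split; split.
Qed.
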